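(* Let $\langle R,\sim\rangle$ be the Rado graph, $A\in\mathbb P(R)$, and let $\mathcal D=\langle\mathcal D_n:n\in\omega\rangle$ be a sequence of subsets of $\mathbb P(R)$ each of which is dense below $A$. Then the set $\mathcal F=\{L: L\text{ is a fusion of }\mathcal D\}$ is dense below $A$ (i.e., for every $B\in\mathbb P(R)$ with $B\subset A$ there is $L\in\mathcal F$ with $L\subset B$).
   Context: The Rado graph $\langle R,\sim\rangle$ is the unique countable graph such that $R^H_K\neq\emptyset$ for all finite $K\subset H\subset R$, where $R^H_K=\{v\in R\setminus H:\forall k\in K\,(v\sim k)\wedge\forall h\in H\setminus K\,(v\not\sim h)\}$; for $L\subset R$, $L^H_K=L\cap R^H_K$. $\mathbb P(R)$ is the set of subsets of $R$ whose induced subgraph is isomorphic to $R$, ordered by inclusion; a set $\mathcal D\subset\mathbb P(R)$ is dense below $A$ iff every $B\in\mathbb P(R)$ with $B\subset A$ contains some element of $\mathcal D$. A labeling of $L\in\mathbb P(R)$ is a pair consisting of a partition $\{L_n:n\in\omega\}$ of $L$ and a bijection $(n,K)\mapsto q^{\bigcup_{i<n}L_i}_K$ from $\bigcup_n\{n\}\times P(\bigcup_{i<n}L_i)$ onto $L$ such that $L_n=\{q^{\bigcup_{i<n}L_i}_K:K\subset\bigcup_{i<n}L_i\}$ and $q^{\bigcup_{i<n}L_i}_K\in L^{\bigcup_{i<n}L_i}_K$. A copy $L\in\mathbb P(R)$ is a fusion of a sequence $\langle\mathcal D_n:n\in\omega\rangle$ of subsets of $\mathbb P(R)$ iff $L$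 has a labeling such that for every $n\in\omega$ and every $K\subset\bigcup_{i<n}L_i$ there is $D\in\mathcal D_n$ with $L^{\bigcup_{i<n}L_i}_K\subset D$. *)

(* Defs.v *)
From mathcomp Require Import all_boot.
From mathcomp Require Import boolp classical_sets functions cardinality.

Set Implicit Arguments.
Unset Strict Implicit.
Unset Printing Implicit Defensive.

Local Open Scope classical_set_scope.

(* R^H_K, where R is the whole type T *)
Definition ext_set (T : Type) (sim : T -> T -> Prop) (H K : set T) : set T :=
  [set v | [/\ ~ H v, forall k, K k -> sim v k
             & forall h, (H `\` K) h -> ~ sim v h]].

Record rado_graph (T : Type) (sim : T -> T -> Prop) : Prop := RadoGraph {
  rado_sym : forall x y, sim x y -> sim y x;
  rado_irrefl : forall x, ~ sim x x;
  rado_countable : countable [set: T];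
  rado_ext : forall H K : set T,
    finite_set H -> K `<=` H -> ext_set sim H K !=set0
}.

(* P(R): the bijection f is an isomorphism from the whole graph onto the
   subgraph induced on L. *)
Definition copies (T : Type) (sim : T -> T -> Prop) : set (set T) :=
  [set L | exists f : T -> T, set_bij [set: T] L f /\
             forall x y, sim x y <-> sim (f x) (f y)].

Definition dense_below (T : Type) (sim : T -> T -> Prop) (A : set T)
    (D : set (set T)) : Prop :=
  forall B, copies sim B -> B `<=` A -> exists2 C, D C & C `<=` B.

Definition below (T : Type) (Ls : nat -> set T) (n : nat) : set T :=
  \bigcup_(i in [set i | (i < n)%N]) Ls i.

(* [q n K] is the vertex labeled by (n, K); it is meaningful only for
   K `<=` below Ls n. *)
Record labeling (T : Type) (sim : T -> T -> Prop) (L : set T)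
    (Ls : nat -> set T) (q : nat -> set T -> T) : Prop := Labeling {
  labeling_partition : partition [set: nat] Ls L;
  labeling_bij : set_bij [set p : nat * set T | p.2 `<=` below Ls p.1] L
                   (fun p => q p.1 p.2);
  labeling_level : forall n, Ls n = [set q n K | K in [set K | K `<=` below Ls n]];
  labeling_ext : forall n K, K `<=` below Ls n ->
    (L `&` ext_set sim (below Ls n) K) (q n K)
}.

Definition fusion (T : Type) (sim : T -> T -> Prop)
    (D : nat -> set (set T)) (L : set T) : Prop :=
  copies sim L /\
  exists (Ls : nat -> set T) (q : nat -> set T -> T),
    labeling sim L Ls q /\
    forall n K, K `<=` below Ls n ->
      exists2 C, D n C & L `&` ext_set sim (below Ls n) K `<=` C.

(* Main.v *)
Require Import Defs.
From mathcomp Require Import all_boot.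
From mathcomp Require Import boolp classical_sets functions cardinality.

Local Open Scope classical_set_scope.

(** Fix a labeling of the whole graph with finite initial segments [F n].  A
    decreasing sequence of embeddings [phi n] of the Rado graph into itself is
    built such that [phi n.+1] agrees with [phi n] on [F n] and sends each
    [ext_set sim (F n) K] into a member of [D n]; the limit of the [phi n] is
    an embedding, and the image of the labeling witnesses that its range is a
    fusion.

    The difficulty is to shrink all the sets [ext_set sim F K], [K `<=` F], into
    members of [D n] while keeping their mutual position generic.  To this end
    choose "twin" copies [x K] of the graph inside [ext_set sim F K] such that
    [x K c] is adjacent to [x K' c'] iff [c] is adjacent to [c'].  An embedding
    [f] shrinks all the twin copies simultaneously, so finitely many applications of
    density give an [f] sending each [x K \o f] into a member of [D n].
    Fixing [F] pointwise and sending [u] outside [F] to [x K (f u)], where [K] is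
    the neighborhood of [u] in [F], is then an embedding again. *)

(** * Finite power sets and initial segments *)

Lemma finite_powerset {T : Type} (F : set T) :
  finite_set F -> finite_set [set K | K `<=` F].
Proof.
move=> finF; have [s ->] := (@finite_seqP {classic T} F).1 finF.
elim: s => [|x s IHs].
  apply: (@sub_finite_set _ _ [set set0]); last exact: finite_set1.
  by move=> K /= K0; apply/seteqP; split=> // y /K0.
apply: (@sub_finite_set _ _ ([set K | K `<=` [set` s]] `|`
    [set x |` K | K in [set K : set T | K `<=` [set` s]]])); last first.
  by rewrite finite_setU; split=> //; exact: finite_image.
move=> K /= sK.
have sKx : K `\` [set x] `<=` [set` s].
  by move=> y [/sK /=]; rewrite inE => /orP[/eqP->|].
case: (pselect (K x)) => Kx; last first.
  by left=> y Ky; apply: sKx; split=> // yx; apply: Kx; rewrite -yx.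
by right; exists (K `\` [set x]) => //; rewrite setD1K.
Qed.

Lemma below0 (T : Type) (Ls : nat -> set T) : below Ls 0 = set0.
Proof. by apply/seteqP; split=> // x []. Qed.

Lemma belowS (T : Type) (Ls : nat -> set T) n :
  below Ls n.+1 = below Ls n `|` Ls n.
Proof.
apply/seteqP; split=> [x [i /= ]|x [[i /= lt_in Lix]|Lnx]].
- by rewrite ltnS leq_eqVlt => /orP[/eqP->|lt_in] Lix; [right|left; exists i].
- by exists i => //=; exact: ltnW.
- by exists n => /=.
Qed.

Lemma subset_below (T : Type) (Ls : nat -> set T) m n :
  (m <= n)%N -> below Ls m `<=` below Ls n.
Proof.
by move=> le_mn x [i /= lt_im Lix]; exists i => //=; exact: leq_trans le_mn.
Qed.

(** * Extension sets and labelings *)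

Section Graph.
Context {T : Type} (sim : T -> T -> Prop).

Lemma ext_setP {H K : set T} {v h} :
  ext_set sim H K v -> H h -> sim v h <-> K h.
Proof.
move=> [_ vK vH] Hh; split=> [vh|]; last exact: vK.
by apply: contrapT => nKh; exact: (vH h).
Qed.

Lemma ext_set_inj {H K K' : set T} {v} : K `<=` H -> K' `<=` H ->
  ext_set sim H K v -> ext_set sim H K' v -> K = K'.
Proof.
move=> KH K'H Kv K'v; apply/seteqP; split=> h Kh.
  by apply/(ext_setP K'v (KH _ Kh))/(ext_setP Kv (KH _ Kh)).
by apply/(ext_setP Kv (K'H _ Kh))/(ext_setP K'v (K'H _ Kh)).
Qed.

(** Disjointness and injectivity come for free: a vertex of level [j] lies outside [below Ls j],
    hence in no earlier level, and within level [n] the set [K] is recovered from [q n K] as its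
    neighborhood in [below Ls n]. *)
Lemma labelingI (L : set T) (Ls : nat -> set T) (q : nat -> set T -> T) :
  \bigcup_n Ls n = L ->
  (forall n, Ls n = [set q n K | K in [set K | K `<=` below Ls n]]) ->
  (forall n K, K `<=` below Ls n -> ext_set sim (below Ls n) K (q n K)) ->
  labeling sim L Ls q.
Proof.
move=> coverL levelE extq.
have Lq n K : K `<=` below Ls n -> Ls n (q n K).
  by move=> sK; rewrite levelE; exists K.
have disj i j x : (i < j)%N -> Ls i x -> Ls j x -> False.
  move=> lt_ij Lix; rewrite levelE => -[K sK qx].
  by have [+ _ _] := extq _ _ sK; rewrite qx; apply; exists i.
have trivL i j x : Ls i x -> Ls j x -> i = j.
  move=> Lix Ljx; case: (ltngtP i j) => // ltij.
    by case: (disj _ _ _ ltij Lix Ljx).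
  by case: (disj _ _ _ ltij Ljx Lix).
split=> //.
- split=> // [i j _ _ [x [Lix Ljx]]|i _]; first exact: trivL Lix Ljx.
  by exists (q i set0); exact: Lq.
- split=> [[n K] /= sK|[n K] [m K'] /=|x].
  + by rewrite -coverL; exists n => //; exact: Lq.
  + rewrite !inE /= => sK sK' qE.
    have nm : n = m by apply: (trivL _ _ (q n K)); [|rewrite qE]; exact: Lq.
    rewrite -nm in sK' qE *; congr (_, _).
    by apply: (ext_set_inj sK sK' (extq _ _ sK)); rewrite qE; exact: extq.
  + by rewrite -coverL => -[n _]; rewrite {1}levelE => -[K sK <-]; exists (n, K).
- move=> n K sK; split; last exact: extq.
  by rewrite -coverL; exists n => //; exact: Lq.
Qed.

(** * Embeddings and copies *)

Definition embedding (f : T -> T) : Prop :=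
  injective f /\ forall x y, sim x y <-> sim (f x) (f y).

Lemma embedding_comp f g :
  embedding f -> embedding g -> embedding (f \o g).
Proof.
move=> [fI fE] [gI gE]; split=> [|x y /=]; first exact: inj_comp.
by rewrite gE.
Qed.

Lemma copies_range f : embedding f -> copies sim (range f).
Proof.
move=> [fI fE]; exists f; split=> //; split=> [x _|x y _ _ /fI|x] //.
Qed.

Lemma copies_embedding C :
  copies sim C -> exists2 f, embedding f & range f = C.
Proof.
move=> [f [[fC fI fS] fE]]; exists f.
  by split=> // x y; apply: fI; rewrite inE.
by apply/seteqP; split=> // x [y _ <-]; exact: fC.
Qed.

(** Passing to a subcopy of [range g] amounts to precomposing [g] with an embedding; the same
    embedding can then be precomposed with all twin copies at once. *)
Lemma embedding_factor g h : embedding g -> embedding h ->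
  range h `<=` range g -> exists2 f, embedding f & g \o f = h.
Proof.
move=> [gI gE] [hI hE] hg.
have /choice[f fP] (u : T) : exists t, g t = h u.
  by have [t _] := hg (h u) (ex_intro2 _ _ u I erefl); exists t.
exists f; last exact/funext.
split=> [x y fxy|x y]; first by apply: hI; rewrite -!fP fxy.
by rewrite hE -!fP -gE.
Qed.

Lemma embedding_ext_set f H K v : embedding f ->
  ext_set sim (f @` H) (f @` K) (f v) <-> ext_set sim H K v.
Proof.
move=> [fI fE]; split=> -[nHv vK vH]; split.
- by move=> Hv; apply: nHv; exists v.
- by move=> k Kk; apply/fE/vK; exists k.
- move=> h [Hh nKh] /(fE _ _).1; apply: vH; split; first by exists h.
  by move=> [k Kk /fI kh]; apply: nKh; rewrite -kh.
- by move=> [h Hh /fI hv]; apply: nHv; rewrite -hv.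
- by move=> _ [k Kk <-]; exact/(fE _ _).1/vK.
- by move=> _ [[h Hh <-] nKh] /(fE _ _).2; apply: vH; split.
Qed.

Lemma labeling_image f Ls q : embedding f -> labeling sim setT Ls q ->
  labeling sim (range f) (fun n => f @` Ls n) (fun n K => f (q n (f @^-1` K))).
Proof.
move=> femb [[coverL _ _] _ levelE extq]; have [fI _] := femb.
have belowE n : below (fun n => f @` Ls n) n = f @` below Ls n.
  by rewrite /below image_bigcup.
have sub_pre n K : K `<=` f @` below Ls n -> f @^-1` K `<=` below Ls n.
  by move=> sK t /sK[u Lu /fI <-].
have preK n K : K `<=` f @` below Ls n -> f @` (f @^-1` K) = K.
  move=> sK; apply/seteqP; split=> [_ [t Kt <-] //|y Ky].
  by have [t _ ty] := sK _ Ky; exists t => //=; rewrite ty.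
apply: labelingI.
- by rewrite -coverL image_bigcup.
- move=> n; rewrite belowE {1}levelE; apply/seteqP; split.
    move=> _ [_ [K sK <-] <-]; exists (f @` K) => /=; first exact: image_subset.
    by congr (f (q n _)); apply/seteqP; split=> t; [case=> u Ku /fI <-|exists t].
  by move=> _ [K sK <-]; exists (q n (f @^-1` K)) => //; exists (f @^-1` K);
    [exact: sub_pre|].
- move=> n K; rewrite belowE => sK; rewrite -{1}(preK _ _ sK).
  by apply/embedding_ext_set => //; exact: (extq _ _ (sub_pre _ _ sK)).2.
Qed.

(** * Labelings and twin copies in the Rado graph *)

Hypothesis rado : rado_graph sim.

(** Nothing is known about [e] outside the range of [code], so [e] lists every vertex, possibly with
    repetitions. *)
Lemma rado_enum : exists (e : nat -> T) (code : T -> nat), cancel code e.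
Proof.
have [t0 _] := rado_ext rado (finite_set0 T) (@subset_refl _ set0).
have [code codeI] := countable_injP _ (rado_countable rado).
have /choice[e eP] (n : nat) : exists t, forall u, code u = n -> t = u.
  case: (pselect (exists u, code u = n)) => [[u <-]|nu].
    by exists u => v vu; apply: codeI; rewrite ?inE.
  by exists t0 => u un; case: nu; exists u.
by exists e, code => t; exact: eP.
Qed.

Lemma rado_pick : exists pick : set T -> set T -> T,
  forall H K, finite_set H -> K `<=` H -> ext_set sim H K (pick H K).
Proof.
have [t0 _] := rado_ext rado (finite_set0 T) (@subset_refl _ set0).
have /choice[pick pickP] (HK : set T * set T) : exists v,
    finite_set HK.1 -> HK.2 `<=` HK.1 -> ext_set sim HK.1 HK.2 v.
  case: (pselect (finite_set HK.1 /\ HK.2 `<=` HK.1)) => [[fH sK]|nH].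
    by have [v] := rado_ext rado fH sK; exists v.
  by exists t0 => *; case: nH.
by exists (fun H K => pick (H, K)) => H K; exact: pickP (H, K).
Qed.

Lemma rado_labeling : exists Ls q,
  labeling sim setT Ls q /\ forall n, finite_set (below Ls n).
Proof.
have [e [code codeK]] := rado_enum; have [pick pickP] := rado_pick.
(* The scheduled vertex [c] is preferred whenever it fits, which makes the levels exhaust the
   graph. *)
pose step F c K := if `[< ext_set sim F K c >] then c else pick F K.
have stepP F c K : finite_set F -> K `<=` F -> ext_set sim F K (step F c K).
  by rewrite /step => fF KF; case: asboolP => // _; exact: pickP.
pose stage := fix stage n : set T := if n is m.+1 then
  stage m `|` [set step (stage m) (e m) K | K in [set K | K `<=` stage m]]
  else set0.
pose q n := step (stage n) (e n).
pose Ls n := [set q n K | K in [set K | K `<=` stage n]].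
have belowE n : below Ls n = stage n.
  by elim: n => [|n IHn]; rewrite ?below0 // belowS IHn.
have fin n : finite_set (stage n).
  elim: n => [|n IHn] /=; first exact: finite_set0.
  by rewrite finite_setU; split=> //; apply/finite_image/finite_powerset.
exists Ls, q; split=> [|n]; last by rewrite belowE.
apply: labelingI => [|n|n K]; rewrite ?belowE //; last exact: stepP.
apply/seteqP; split=> // t _.
suff : below Ls (code t).+1 t by move=> [i _ Lit]; exists i.
rewrite belowE /=; case: (pselect (stage (code t) t)) => [|nt]; first by left.
(* A vertex still missing at stage [code t] fits the label given by its own neighborhood in that
   stage. *)
right; exists (stage (code t) `&` sim t) => [|/=]; first exact: subIsetl.
rewrite codeK /step; case: asboolP => // -[]; split=> // [k []//|h [sh nh] th].
by apply: nh.
Qed.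

(** Recursion along the enumeration: the twins of [e m] are chosen over [F] and all twins chosen
    before, with the prescribed adjacencies. Twins [x K c] and [x K' c] of the same [c] are chosen
    independently of each other, hence the restriction to [c <> c']. *)
Lemma rado_twins F : finite_set F -> exists x : set T -> T -> T,
  (forall K c, K `<=` F -> ext_set sim F K (x K c)) /\
  (forall K K' c c', K `<=` F -> K' `<=` F -> c <> c' ->
     x K c <> x K' c' /\ (sim (x K c) (x K' c') <-> sim c c')).
Proof.
move=> finF; have [e [code codeK]] := rado_enum.
have [pick pickP] := rado_pick.
(* [s] is the set of the pairs [(c, x K c)] constructed so far *)
pose dom (s : set (T * T)) := F `|` [set p.2 | p in s].
pose adj (s : set (T * T)) c K := K `|` [set y | exists2 b, s (b, y) & sim b c].
pose X s c K := pick (dom s) (adj s c K).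
pose st := fix st n : set (T * T) := if n is m.+1 then
  st m `|` [set (e m, X (st m) (e m) K) | K in [set K | K `<=` F]] else set0.
have st_fin n : finite_set (st n).
  elim: n => [|n IHn] /=; first exact: finite_set0.
  by rewrite finite_setU; split=> //; apply/finite_image/finite_powerset.
have XP n c K : K `<=` F ->
    ext_set sim (dom (st n)) (adj (st n) c K) (X (st n) c K).
  move=> KF; apply: pickP.
    by rewrite finite_setU; split=> //; exact/finite_image.
  by move=> y [/KF|[b sb _]]; [left|right; exists (b, y)].
have st_notF n c y : st n (c, y) -> ~ F y.
  elim: n => [//|n IHn] /= [/IHn //|[K KF [_ <-]]] Fy.
  by have [+ _ _] := XP n (e n) _ KF; apply; left.
(* A chosen vertex stands for only one [c], because new choices avoid [dom]; so its membership in
   [adj] is decided by that single [c]. *)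
have st_fun n c c' y : st n (c, y) -> st n (c', y) -> c = c'.
  have new b K : K `<=` F -> forall m, st m (b, X (st m) (e m) K) -> False.
    move=> KF m sm; have [+ _ _] := XP m (e m) _ KF; apply; right.
    by exists (b, X (st m) (e m) K).
  elim: n => [//|n IHn] /= [s1|[K KF [<- yE]]] [s2|[K' KF' [<- yE']]] //.
  - exact: IHn s1 s2.
  - by move: s1; rewrite -yE' => /new; case.
  - by move: s2; rewrite -yE => /new; case.
have st_mono m n : (m <= n)%N -> st m `<=` st n.
  elim: n => [|n IHn]; first by rewrite leqn0 => /eqP ->.
  rewrite leq_eqVlt => /orP[/eqP-> //|]; rewrite ltnS => /IHn smn.
  by move=> p /smn; left.
(* If [e] repeats [c], several families of twins arise; [x] takes the one of stage [code c]. *)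
pose x K c := X (st (code c)) c K.
have key K K' c c' : K `<=` F -> K' `<=` F -> (code c < code c')%N ->
    x K' c' <> x K c /\ (sim (x K' c') (x K c) <-> sim c c').
  move=> KF KF' lt_cc'.
  have sc : st (code c') (c, x K c).
    by apply: (st_mono _ _ lt_cc'); right; exists K => //; rewrite codeK.
  have domx : dom (st (code c')) (x K c) by right; exists (c, x K c).
  have extx := XP (code c') c' _ KF'.
  split; first by have [+ _ _] := extx; rewrite -/(x K' c') => + eqx; rewrite eqx.
  apply: (iff_trans (ext_setP extx domx)); split=> [[/KF'|[b sb]]|cc'].
  - by move/(st_notF _ _ _ sc).
  - by rewrite (st_fun _ _ _ _ sb sc).
  - by right; exists c.
exists x; split=> [K c KF|K K' c c' KF KF' ncc'].
  have [ndom xK xnK] := XP (code c) c _ KF; split=> [Fx|k Kk|h [Fh nKh]].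
  - by apply: ndom; left.
  - by apply: xK; left.
  - by apply: xnK; split; [left|move=> [//|[b /st_notF]]].
have symE a b : sim a b <-> sim b a by split; exact: rado_sym.
case: (ltngtP (code c) (code c')) => [lt|lt|/(can_inj codeK) //].
  by have [nx xE] := key K K' c c' KF KF' lt; split; [exact/nesym|rewrite symE].
by have [nx xE] := key K' K c' c KF' KF lt; split=> //; rewrite xE symE.
Qed.

(** * One step of the fusion *)

Lemma rado_shrink (A : set T) D phi F :
  D `<=` copies sim -> dense_below sim A D ->
  embedding phi -> range phi `<=` A -> finite_set F ->
  exists psi, [/\ embedding psi, {in F, psi =1 phi}, range psi `<=` range phi &
    forall K, K `<=` F -> exists2 C, D C & psi @` ext_set sim F K `<=` C].
Proof.
move=> Dcopies Ddense phi_emb phiA finF.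
have [x [xext xtwin]] := rado_twins F finF.
have x_emb K : K `<=` F -> embedding (x K).
  move=> KF; split=> [c c' xE|c c'].
    by apply: contrapT => ncc'; case: (xtwin K K c c' KF KF ncc').
  case: (pselect (c = c')) => [<-|ncc'].
    by split=> /(rado_irrefl rado).
  by have [_ ->] := xtwin K K c c' KF KF ncc'.
(* The sets [K] are treated one after another. Each replaces [f] by [f \o k], which only shrinks the
   ranges, so the inclusions already obtained persist. *)
have [f f_emb fD] : exists2 f, embedding f & forall K, K `<=` F ->
    exists2 C, D C & range (phi \o x K \o f) `<=` C.
  have [s sE] := (finite_seqP _).1 (finite_powerset F finF).
  suff [f f_emb fD] : exists2 f, embedding f &
      forall K, K \in s -> exists2 C, D C & range (phi \o x K \o f) `<=` C.
    exists f => // K KF; apply: fD.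
    by have : [set K | K `<=` F] K by []; rewrite sE.
  have : {subset s <= [pred K | `[< K `<=` F >]]}.
    move=> K Ks; apply/asboolP.
    by have : [set` s] K by []; rewrite -sE.
  elim: s {sE} => [|K s IHs] sF.
    by exists id => //; split=> // x y.
  have [K' K's|f f_emb fD] := IHs; first by apply: sF; rewrite inE K's orbT.
  have /asboolP KF : K \in [pred K | `[< K `<=` F >]].
    by apply: sF; rewrite inE eqxx.
  have g_emb : embedding (phi \o x K \o f).
    by apply: embedding_comp => //; apply: embedding_comp => //; exact: x_emb.
  have [|C DC Cg] := Ddense _ (copies_range _ g_emb).
    by move=> _ [u _ <-]; apply: phiA; exists (x K (f u)).
  have [h h_emb hC] := copies_embedding _ (Dcopies _ DC).
  have [|k k_emb kE] := embedding_factor _ _ g_emb h_emb; first by rewrite hC.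
  exists (f \o k) => [|K']; first exact: embedding_comp.
  rewrite inE => /orP[/eqP->|/fD[C' DC' C'f]].
    by exists C => //; rewrite -hC -kE.
  by exists C' => // _ [u _ <-]; apply: C'f; exists (k u).
pose N u := F `&` sim u.
have NF u : N u `<=` F by exact: subIsetl.
have extN K u : K `<=` F -> ext_set sim F K u -> N u = K.
  move=> KF Ku; apply/seteqP; split=> [h [Fh /(ext_setP Ku Fh)] //|h Kh].
  by split; [exact: KF|exact/(ext_setP Ku (KF _ Kh))].
pose w u := if `[< F u >] then u else x (N u) (f u).
have wF u : F u -> w u = u by rewrite /w; case: asboolP.
have wN u : ~ F u -> w u = x (N u) (f u) by rewrite /w; case: asboolP.
have [fI fE] := f_emb.
have wFN u v : F u -> ~ F v -> w v <> u /\ (sim (w v) u <-> sim v u).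
  move=> Fu Fv; rewrite wN //; have extv := xext _ (f v) (NF v).
  split; first by move=> vu; have [+ _ _] := extv; rewrite vu.
  by apply: (iff_trans (ext_setP extv Fu)); split=> [[]|].
have symE a b : sim a b <-> sim b a by split; exact: rado_sym.
have w_emb : embedding w.
  (* For distinct [u] and [v] outside [F], injectivity of [f] makes the indices [f u] and [f v]
     distinct, so the twin property applies even when [N u] and [N v] differ. *)
  split=> [u v|u v]; case: (pselect (F u)) (pselect (F v)) => Fu [] Fv.
  - by rewrite !wF.
  - by rewrite (wF u) // => uE; case: (wFN u v Fu Fv) => /nesym.
  - by rewrite (wF v) // => uE; case: (wFN v u Fv Fu).
  - rewrite !wN // => uE; apply: contrapT => nuv.
    by case: (xtwin _ _ (f u) (f v) (NF u) (NF v)) => // /fI.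
  - by rewrite !wF.
  - by rewrite (wF u) // symE [X in _ <-> X]symE; have [_ ->] := wFN u v Fu Fv.
  - by rewrite (wF v) //; have [_ ->] := wFN v u Fv Fu.
  - case: (pselect (u = v)) => [<-|nuv]; first by split=> /(rado_irrefl rado).
    rewrite !wN // fE.
    by have [/fI//|_ ->] := xtwin _ _ (f u) (f v) (NF u) (NF v).
exists (phi \o w); split.
- exact: embedding_comp.
- by move=> u; rewrite inE /= => /wF ->.
- by move=> _ [u _ <-]; exists (w u).
- move=> K KF; have [C DC Cx] := fD K KF; exists C => // _ [u Ku <-].
  have [nFu _ _] := Ku; rewrite /= wN // (extN _ _ KF Ku).
  by apply: Cx; exists u.
Qed.

End Graph.

(** * The fusion sequence and its limit *)

Theorem theorem5p1 (T : Type) (sim : T -> T -> Prop) (A : set T)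
    (D : nat -> set (set T)) :
  rado_graph sim ->
  copies sim A ->
  (forall n, D n `<=` copies sim) ->
  (forall n, dense_below sim A (D n)) ->
  dense_below sim A [set L | fusion sim D L].
Proof.
move=> rado _ Dcopies Ddense B /copies_embedding[phi0 phi0_emb <-] BA.
have [Ls [q [labT finF]]] := rado_labeling _ rado.
pose F := below Ls.
(* The step number is paired with the current embedding since [F] and [D] depend on it; the required
   properties are premises, so that [next] is total. *)
have /choice[next nextP] (p : nat * (T -> T)) : exists psi,
    embedding sim p.2 -> range p.2 `<=` A ->
    [/\ embedding sim psi, {in F p.1, psi =1 p.2}, range psi `<=` range p.2 &
      forall K, K `<=` F p.1 ->
        exists2 C, D p.1 C & psi @` ext_set sim (F p.1) K `<=` C].
  case: (pselect (embedding sim p.2 /\ range p.2 `<=` A)) => [[pe pA]|np].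
    have [psi psiP] := rado_shrink _ rado _ _ _ (F p.1)
      (Dcopies p.1) (Ddense p.1) pe pA (finF p.1).
    by exists psi.
  by exists id => ? ?; case: np.
pose phi := fix phi n := if n is m.+1 then next (m, phi m) else phi0.
have phi_good n : embedding sim (phi n) /\ range (phi n) `<=` A.
  elim: n => [//|n [IHe IHA]]; have [e _ s _] := nextP (n, phi n) IHe IHA.
  by split=> //; exact: subset_trans IHA.
have phi_emb n : embedding sim (phi n) by have [] := phi_good n.
have phiS n := nextP (n, phi n) (phi_good n).1 (phi_good n).2.
have phi_eq m n t : (m <= n)%N -> F m t -> phi n t = phi m t.
  move=> + Ft; elim: n => [|n IHn]; first by rewrite leqn0 => /eqP->.
  rewrite leq_eqVlt => /orP[/eqP-> //|]; rewrite ltnS => le_mn.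
  have [_ eqF _ _] := phiS n; rewrite -(IHn le_mn); apply: eqF.
  by rewrite inE; exact: subset_below Ft.
have phi_range m n : (m <= n)%N -> range (phi n) `<=` range (phi m).
  elim: n => [|n IHn]; first by rewrite leqn0 => /eqP->.
  rewrite leq_eqVlt => /orP[/eqP-> //|]; rewrite ltnS => /IHn.
  by apply: subset_trans; have [] := phiS n.
have /choice[lv lvP] (t : T) : exists n, F n t.
  have [[coverT _ _] _ _ _] := labT.
  by have [n _ Lt] : cover setT Ls t; [rewrite coverT|exists n.+1, n => /=].
(* The pointwise limit: the values [phi n t] are constant once [F n] contains [t]. *)
pose Phi t := phi (lv t) t.
have PhiE n t : F n t -> Phi t = phi n t.
  move=> Ft; rewrite /Phi; case/orP: (leq_total (lv t) n) => le.
    by rewrite -(phi_eq _ _ _ le (lvP t)).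
  by rewrite (phi_eq _ _ _ le Ft).
have Phi_emb : embedding sim Phi.
  have common t u : exists2 n, F n t & F n u.
    exists (maxn (lv t) (lv u)); apply: subset_below (lvP _).
      exact: leq_maxl.
    exact: leq_maxr.
  split=> t u; have [n Ft Fu] := common t u; rewrite !(PhiE n) //.
    by have [+ _] := phi_emb n; apply.
  by have [_] := phi_emb n; apply.
exists (range Phi); last first.
  by move=> _ [t _ <-]; apply: (phi_range 0 (lv t)) => //; exists t.
split; first exact: copies_range.
have labP := labeling_image _ _ _ _ Phi_emb labT.
do 2 eexists; split; first exact: labP.
move=> n K; rewrite /below -image_bigcup -/(below _ n) => sK.
(* The label [K] lives in the image, whereas [phi n.+1] was built for labels inside [F n]; [K0] is
   the matching one. *)
pose K0 := F n `&` Phi @^-1` K.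
have K0F : K0 `<=` F n by exact: subIsetl.
have [e eqF _ /(_ _ K0F)[C DC sC]] := phiS n.
exists C => // _ [[t _ <-] extt].
have nFt : ~ F n t by move=> Ft; have [+ _ _] := extt; apply; exists t.
(* As [t] is outside [F n], its value is fixed at a stage after [n], so [Phi t] lies in the range of
   [phi n.+1]. Its preimage [u] there may differ from [t]. *)
have lt_n : (n < lv t)%N.
  rewrite ltnNge; apply/negP => le; apply: nFt.
  exact: subset_below le _ (lvP t).
have [u _ uE] : range (phi n.+1) (Phi t).
  by apply: (phi_range _ _ lt_n); exists t.
apply: sC; exists u => //.
have FE h : F n h -> Phi h = phi n.+1 h.
  by move=> Fh; apply: PhiE; exact: subset_below Fh.
apply/(embedding_ext_set _ (phi n.+1)) => //; rewrite uE.
have -> : phi n.+1 @` K0 = K.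
  apply/seteqP; split=> [_ [h [Fh Kh] <-]|y Ky]; first by rewrite -FE.
  by have [h Fh hy] := sK _ Ky; exists h; [split=> //=; rewrite hy|rewrite -FE].
suff -> : phi n.+1 @` F n = Phi @` F n by [].
by apply/seteqP; split=> _ [h Fh <-]; exists h; rewrite ?FE.
Qed.
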